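(* Let $\mathcal G$ be the class of all stationary and ergodic binary Markov chains of arbitrary finite order. Then there is no classification for $\mathcal G$ in a pointwise sense, and there is no classification for $\mathcal G$ in probability.
   Context: A binary process is a sequence of $\{0,1\}$-valued random variables $\{X_n\}_{n=1}^\infty$. A binary process is a Markov chain of finite order if for some integer $k\ge 0$ the conditional distribution of the next symbol given the past depends only on the last $k$ symbols ($k=0$ meaning independence of the past). Chains of all finite orders, mixing or not, are considered. Let $\mathcal G$ be a subclass of the class of all stationary and ergodic binary processes. A sequence of functions $g_n:\{0,1\}^n\to\{YES,NO\}$, $n\ge1$, is a classification for $\mathcal G$ in probability if $\lim_{n\to\infty}P(g_n(X_1,\dots,X_n)=YES)=1$ for all processes $\{X_n\}$ in $\mathcal G$, and $\lim_{n\to\infty}P(g_n(X_1,\dots,X_n)=NO)=1$ for all stationary and ergodic binary processes $\{X_n\}$ not in $\mathcal G$. It is a classification for $\mathcal G$ in a pointwise sense if, almost surely, $g_n(X_1,\dots,X_n)=YES$ for all sufficiently large $n$, for all processes $\{X_n\}$ in $\mathcal G$; and, almost surely, $g_n(X_1,\dots,X_n)=NO$ for all sufficiently large $n$, for all stationary and ergodic binary processes $\{X_n\}$ not in $\mathcal G$. *)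

(* Defs.v *)
From HB Require Import structures.
From mathcomp Require Import all_boot all_order all_algebra.
From mathcomp Require Import all_classical all_reals all_analysis.

Set Implicit Arguments.
Unset Strict Implicit.
Unset Printing Implicit Defensive.

Import Order.TTheory GRing.Theory Num.Theory.
Import numFieldNormedType.Exports.

Local Open Scope classical_set_scope.
Local Open Scope ring_scope.

(* [rv p i] is the variable X_{i+1}: indices start at 0 instead of 1, so that
   X_1, ..., X_n are [rv p 0], ..., [rv p n.-1].  The symbols 0 and 1 are
   [false] and [true].  The sample space is arbitrary and may vary from one
   process to another. *)
Record binary_process (R : realType) := BinaryProcess {
  disp : measure_display ;
  space : measurableType disp ;
  law : probability space R ;
  rv : nat -> {RV law >-> bool} }.

Section processes.
Variable R : realType.
Implicit Type p : binary_process R.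

Definition path_of p (w : space p) : nat -> bool := fun i => rv p i w.

Definition prefix_of p (n : nat) (w : space p) : n.-tuple bool :=
  [tuple rv p i w | i < n].

Definition stationary p : Prop :=
  forall (k n : nat) (x : nat -> bool),
    law p [set w | forall i, (i < n)%N -> rv p (k + i)%N w = x i] =
    law p [set w | forall i, (i < n)%N -> rv p i w = x i].

Definition shift_path (x : nat -> bool) : nat -> bool := fun i => x i.+1.

(* The product sigma-algebra on {0,1}^N. *)
Definition measurable_path : set (set (nat -> bool)) :=
  <<s [set A | exists (i : nat) (b : bool), A = [set x | x i = b]] >>.

Definition ergodic p : Prop :=
  forall A : set (nat -> bool), measurable_path A -> shift_path @^-1` A = A ->
    law p (@path_of p @^-1` A) = 0%E \/ law p (@path_of p @^-1` A) = 1%E.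

(* Used below only when B has positive probability. *)
Definition cond_prob d (T : measurableType d) (P : probability T R)
  (A B : set T) : R := fine (P (A `&` B)) / fine (P B).

(* The event that the process agrees with x at the indices i, ..., j - 1. *)
Definition agree p (x : nat -> bool) (i j : nat) : set (space p) :=
  [set w | forall m, (i <= m < j)%N -> rv p m w = x m].

(* P(X_{n+1} = x_{n+1} | X_1 = x_1, ..., X_n = x_n)
     = P(X_{n+1} = x_{n+1} | X_{n-k+1} = x_{n-k+1}, ..., X_n = x_n);
   the words are the initial segments of an infinite sequence x.  For k = 0 the
   right-hand condition is the sure event. *)
Definition markov_of_order p (k : nat) : Prop :=
  forall (n : nat) (x : nat -> bool), (k <= n)%N ->
    (0 < law p (agree x 0 n))%E ->
    cond_prob (law p) (agree x n n.+1) (agree x 0 n) =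
    cond_prob (law p) (agree x n n.+1) (agree x (n - k) n).

Definition stationary_ergodic p : Prop := stationary p /\ ergodic p.

Definition finite_order_markov p : Prop :=
  stationary_ergodic p /\ exists k : nat, markov_of_order p k.

End processes.

Variant answer := YES | NO.

(* The extra function on words of length n = 0 plays no role. *)
Definition test_sequence := forall n : nat, n.-tuple bool -> answer.

(* In both definitions G is meant to be a subclass of [stationary_ergodic].  It
   is a predicate, not a [set], because [binary_process R] is too large for the
   universe of [set]. *)
Definition classification_in_probability (R : realType)
    (G : binary_process R -> Prop) (g : test_sequence) : Prop :=
  (forall p, G p ->
    law p [set w | g n (prefix_of n w) = YES] @[n --> \oo] --> 1%E) /\
  (forall p, stationary_ergodic p -> ~ G p ->
    law p [set w | g n (prefix_of n w) = NO] @[n --> \oo] --> 1%E).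

Definition classification_pointwise (R : realType)
    (G : binary_process R -> Prop) (g : test_sequence) : Prop :=
  (forall p, G p ->
    {ae law p, forall w, \forall n \near \oo, g n (prefix_of n w) = YES}) /\
  (forall p, stationary_ergodic p -> ~ G p ->
    {ae law p, forall w, \forall n \near \oo, g n (prefix_of n w) = NO}).

(* Main.v *)
Require Import Defs.
From mathcomp Require Import all_boot all_order all_algebra.
From mathcomp Require Import all_classical all_reals all_analysis.
From mathcomp Require Import measurable_realfun.
From mathcomp Require Import ring lra zify.

Set Implicit Arguments.
Unset Strict Implicit.
Unset Printing Implicit Defensive.

Import Order.TTheory GRing.Theory Num.Theory.

Local Open Scope classical_set_scope.
Local Open Scope ring_scope.

(** A periodic 0-1 sequence read from a uniformly random phase is a stationary
and ergodic Markov chain of finite order: once a full period has been seen, the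
next symbol is known.  So a classification must end up answering YES on every
such process.  The idea is to glue periodic sequences of growing periods into a
limit that is stationary and ergodic, that has no finite order, and that on a
window of length [n m] is nearly indistinguishable from a periodic sequence on
which the test, reading words of length [n m], already says YES with probability
at least 3/4.  The test then says YES on the limit with probability at least 1/2
for arbitrarily long words, so it cannot converge to NO in probability.  As
almost sure convergence implies convergence in probability, the pointwise
statement follows from the one in probability.

The limit is a Toeplitz process.  Take integers [L j], the periods
[period m = L 0 * ... * L (m - 1)], and let the symbol at time [t] be the parity
of the number of [j < m] such that [period j.+1] divides [t].  Passing from [m]
to [m.+1] flips one symbol out of [period m.+1], so that,
with phases modulo the successive periods chosen compatibly, the sequences
converge almost surely, and the limit agrees with stage [m] on a window of
length [n] up to an event of probability at most [2 n / period m.+1]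
([pr_late_window]).  The random phases live on the unit interval with the uniform law: they are the
mixed-radix digits of a uniform real, read in reverse order
([uniform_phase_phase]).

Stationarity passes to the limit.  Ergodicity follows from a criterion that also
covers the periodic processes ([ergodic_of_frequency]): if every event depending
on finitely many coordinates has, over some window and outside a small event, a
deterministic number of occurrences, then an invariant event is independent of
all such events, hence of itself.

No Markov order ([not_markov]): by near periodicity the process returns, with
probability close to 1, to its first [k.+1] symbols after some positive time.  A
Markov chain with a genuinely random transition would, on coming back to the
state where this transition occurs, draw the other symbol with a probability
bounded below.  So a limit of finite order would be deterministic, and since it
has finitely many states its path would be periodic, with a period that does not
depend on the path; but the flips made at a late stage destroy every period
([aperiodic_limit]).

The integers [L m] are chosen one after the other ([ratios]): [L 0, ..., L (m - 1)]
determine the periodic process of stage [m]; the length [n m] on which the test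
says YES on that process is then chosen, and [L m] is taken much larger than
[n m]. *)

(** * Real-valued probabilities *)

Lemma measurable_countable_fun d (T : measurableType d) (V : countType)
    (f : T -> V) (S : set V) :
  (forall v, measurable [set w | f w = v]) -> measurable [set w | S (f w)].
Proof.
move=> mf; rewrite (_ : mkset _ =
    \bigcup_v [set w | S (f w) /\ f w = v]); last first.
  by apply/seteqP; split => [w /= Sw|w [v _ []]//]; exists (f w).
apply: countable_bigcupT_measurable => // v.
have [Sv|nSv] := pselect (S v).
  rewrite (_ : mkset _ = [set w | f w = v])//.
  by apply/seteqP; split => w /=; [case|move=> fw; rewrite fw].
rewrite (_ : mkset _ = set0) ?measurable0// -subset0 => w /= [Sw fw].
by apply: nSv; rewrite -fw.
Qed.

Section real_probability.
Context d (T : measurableType d) (R : realType) (P : probability T R).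
Implicit Types A B : set T.

(** Real values make linear arithmetic available; nothing is lost, as all the
events involved are measurable. *)
Definition pr A : R := fine (P A).

Lemma prE A : measurable A -> P A = (pr A)%:E.
Proof. by move=> mA; rewrite /pr fineK// fin_num_measure. Qed.

Lemma pr_ge0 A : 0 <= pr A.
Proof. exact/fine_ge0/measure_ge0. Qed.

Lemma pr_set0 : pr set0 = 0.
Proof. by rewrite /pr measure0. Qed.

Lemma pr_setT : pr setT = 1.
Proof. by rewrite /pr probability_setT. Qed.

Lemma le_pr A B : measurable A -> measurable B -> A `<=` B -> pr A <= pr B.
Proof.
by move=> mA mB AB; rewrite -lee_fin -!prE//; apply: le_measure; rewrite ?inE.
Qed.

Lemma pr_le1 A : measurable A -> pr A <= 1.
Proof. by move=> mA; rewrite -pr_setT le_pr. Qed.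

Lemma pr_setU A B : measurable A -> measurable B -> [disjoint A & B] ->
  pr (A `|` B) = pr A + pr B.
Proof.
move=> mA mB AB; apply: EFin_inj; rewrite EFinD -!prE ?measureU//; last first.
  exact: measurableU.
exact/disj_set2P.
Qed.

Lemma pr_splitI A B : measurable A -> measurable B ->
  pr A = pr (A `&` B) + pr (A `&` ~` B).
Proof.
move=> mA mB; rewrite -pr_setU.
- by rewrite -setIUr setUv setIT.
- exact: measurableI.
- by apply: measurableI => //; exact: measurableC.
- by apply/disj_set2P; rewrite setIACA setICr setI0.
Qed.

Lemma le_prU A B : measurable A -> measurable B -> pr (A `|` B) <= pr A + pr B.
Proof.
move=> mA mB; rewrite -lee_fin EFinD -!prE//; last exact: measurableU.
exact: measureU2.
Qed.

Lemma pr_setC A : measurable A -> pr (~` A) = 1 - pr A.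
Proof.
by move=> mA; have := pr_splitI measurableT mA; rewrite !setTI pr_setT; lra.
Qed.

Lemma pr_bigcup_ord n (F : nat -> set T) : (forall i, measurable (F i)) ->
  pr (\bigcup_(i in `I_n) F i) <= \sum_(i < n) pr (F i).
Proof.
move=> mF; elim: n => [|n IH].
  by rewrite big_ord0 (_ : `I_0 = set0) ?bigcup_set0 ?pr_set0// -subset0.
have mU k : measurable (\bigcup_(i in `I_k) F i).
  by apply: bigcup_measurable => i _.
rewrite IIS bigcup_setU bigcup_set1 big_ord_recr/=.
by apply: le_trans (le_prU _ _) _ => //; rewrite lerD2r.
Qed.

(** Integrating over [B] the number of events [E i] that occur. *)
Lemma pr_count (I : Type) (r : seq I) (Q : pred I) (E : I -> set T) B c :
    measurable B -> (forall i, measurable (E i)) ->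
    (forall w, B w -> \sum_(i <- r | Q i) \1_(E i) w = c) ->
  \sum_(i <- r | Q i) pr (B `&` E i) = c * pr B.
Proof.
move=> mB mE Ec; apply: EFin_inj; rewrite -sumEFin EFinM -prE//.
rewrite -integral_cst//.
rewrite (eq_integral (fun w => \sum_(i <- [seq i <- r | Q i]) (\1_(E i) w)%:E)%E).
  rewrite ge0_integral_sum//.
  - rewrite big_filter; apply: eq_bigr => i _.
    by rewrite integral_indic// setIC -prE//; exact: measurableI.
  - by move=> i; apply/measurable_EFinP; exact: measurable_indic.
by move=> w /[!inE] Bw; rewrite big_filter sumEFin Ec.
Qed.

Lemma pr_partition (V : finType) (f : T -> V) (S : pred V) B :
    measurable B -> (forall v, measurable [set w | f w = v]) ->
  pr (B `&` [set w | S (f w)]) = \sum_(v | S v) pr (B `&` [set w | f w = v]).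
Proof.
move=> mB mf.
have mS : measurable [set w | S (f w)].
  exact: (measurable_countable_fun [set v | S v]).
rewrite -[LHS]mul1r -(@pr_count V (index_enum V) S (fun v => [set w | f w = v])).
- apply: eq_bigr => v Sv; congr pr; apply/seteqP; split => w /=.
    by case=> -[].
  by case=> Bw fw; rewrite fw.
- exact: measurableI.
- by [].
- move=> w [_ /= Sw]; rewrite (bigD1 (f w))//= indicE mem_set// big1 ?addr0//.
  by move=> v /andP[_ vf]; rewrite indicE memNset//= => fv; rewrite fv eqxx in vf.
Qed.

End real_probability.

(** * Events on paths *)

Definition determined (n : nat) (Q : set (nat -> bool)) : Prop :=
  forall z z' : nat -> bool, (forall i, (i < n)%N -> z i = z' i) -> Q z -> Q z'.

(** The default value [false] beyond the word is never looked at: [extend v] is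
only fed to sets that depend on the first [n] coordinates. *)
Definition extend n (v : n.-tuple bool) : nat -> bool := nth false v.

Section paths.
Context d (T : measurableType d) (X : nat -> T -> bool).
Hypothesis mX : forall i, measurable_fun setT (X i).

Definition word (n : nat) (w : T) : n.-tuple bool := [tuple X i w | i < n].

Lemma extend_word n w i : (i < n)%N -> extend (word n w) i = X i w.
Proof.
by move=> ltin; rewrite /extend -[i]/(nat_of_ord (Ordinal ltin)) -tnth_nth tnth_mktuple.
Qed.

Lemma determinedE n (Q : set (nat -> bool)) : determined n Q ->
  [set w | Q (X ^~ w)] = [set w | `[< Q (extend (word n w)) >]].
Proof.
move=> dQ; apply/seteqP; split => w /= => [|/asboolP].
  by move=> Qw; apply/asboolP; apply: dQ Qw => i ltin; rewrite extend_word.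
by apply: dQ => i ltin; rewrite extend_word.
Qed.

Lemma word_eqP n w (v : n.-tuple bool) :
  word n w = v <-> forall i, (i < n)%N -> X i w = extend v i.
Proof.
split=> [<- i ltin|Xv]; first by rewrite extend_word.
apply: eq_from_tnth => i.
by rewrite tnth_mktuple Xv// /extend -tnth_nth.
Qed.

Lemma word_eqE n (v : n.-tuple bool) :
  [set w | word n w = v] = [set w | forall i, (i < n)%N -> X i w = extend v i].
Proof. by apply/seteqP; split => w /= /word_eqP. Qed.

Lemma measurable_coord i b : measurable [set w | X i w = b].
Proof. by have := @mX i measurableT [set b] Logic.I; rewrite setTI. Qed.

Lemma measurable_agree n k x :
  measurable [set w | forall i, (i < n)%N -> X (k + i)%N w = x i].
Proof.
rewrite (_ : mkset _ = \bigcap_i [set w | (i < n)%N -> X (k + i)%N w = x i]).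
  apply: bigcapT_measurable => i; case: (i < n)%N.
    rewrite (_ : mkset _ = [set w | X (k + i)%N w = x i]); first exact: measurable_coord.
    by apply/seteqP; split => w /=; [exact|].
  rewrite (_ : mkset _ = setT)//.
  by apply/seteqP; split.
by apply/seteqP; split => w /= Xw i; [move=> _; exact: Xw|exact: Xw].
Qed.

Lemma measurable_word n v : measurable [set w | word n w = v].
Proof.
rewrite word_eqE; exact: (measurable_agree n 0).
Qed.

Lemma measurable_determined n (Q : set (nat -> bool)) : determined n Q ->
  measurable [set w | Q (X ^~ w)].
Proof.
move=> /determinedE->.
exact: (measurable_countable_fun [set v | `[< Q (extend v) >]] (@measurable_word n)).
Qed.

End paths.

Lemma pr_word_sum d (T : measurableType d) (R : realType) (P : probability T R)
    (X : nat -> T -> bool) n (Q : set (nat -> bool)) B :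
    (forall i, measurable_fun setT (X i)) -> measurable B -> determined n Q ->
  pr P (B `&` [set w | Q (X ^~ w)]) =
  \sum_(v : n.-tuple bool | `[< Q (extend v) >])
     pr P (B `&` [set w | word X n w = v]).
Proof.
move=> mX mB /determinedE->.
by rewrite (pr_partition _ (fun v => `[< Q (extend v) >]))// => v; exact: measurable_word.
Qed.

(** Dynkin's lemma: the sets depending on finitely many coordinates are stable
under intersection and generate the sigma-algebra of paths.  The case
[B = setT] compares the laws of [X] and [Y]; the case [X = Y] is the independence
of [B] from the process. *)
Lemma path_law_ext d (T : measurableType d) (R : realType) (P : probability T R)
    (X Y : nat -> T -> bool) B :
    (forall i, measurable_fun setT (X i)) ->
    (forall i, measurable_fun setT (Y i)) ->
    measurable B ->
    (forall n Q, determined n Q ->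
       pr P (B `&` [set w | Q (X ^~ w)]) = pr P B * pr P [set w | Q (Y ^~ w)]) ->
  forall A, measurable_path A ->
    [/\ measurable [set w | A (X ^~ w)], measurable [set w | A (Y ^~ w)] &
        pr P (B `&` [set w | A (X ^~ w)]) = pr P B * pr P [set w | A (Y ^~ w)]].
Proof.
move=> mX mY mB XY.
set H := fun A : set (nat -> bool) => [/\ measurable [set w | A (X ^~ w)],
  measurable [set w | A (Y ^~ w)] &
  pr P (B `&` [set w | A (X ^~ w)]) = pr P B * pr P [set w | A (Y ^~ w)]].
pose G := [set Q | exists n, determined n Q].
have dG : setI_closed G.
  move=> Q1 Q2 [n1 d1] [n2 d2]; exists (maxn n1 n2) => z z' zz' [Q1z Q2z].
  by split; [apply: d1 Q1z|apply: d2 Q2z] => i ltin;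
    apply: zz'; rewrite leq_max ltin ?orbT.
have GH : G `<=` H.
  by move=> Q [n dQ]; split; [exact: measurable_determined dQ|
    exact: measurable_determined dQ|exact: XY dQ].
have lH : lambda_system setT H.
  apply/dynkin_lambda_system; split.
  - by apply: GH; exists 0.
  - move=> A [mAX mAY eA].
    have CX Z : [set w | (~` A) (Z ^~ w)] = ~` [set w : T | A (Z ^~ w)] by [].
    split; rewrite ?CX; [exact: measurableC|exact: measurableC|].
    rewrite pr_setC//; have := pr_splitI P mB mAX; rewrite eA; lra.
  - move=> F tF HF.
    have UZ Z : [set w | (\bigcup_k F k) (Z ^~ w)] =
        \bigcup_k [set w : T | F k (Z ^~ w)] by apply/seteqP; split.
    have mF Z : (forall k, measurable [set w | F k (Z ^~ w)]) ->
        measurable [set w : T | (\bigcup_k F k) (Z ^~ w)].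
      by move=> mF; rewrite UZ; exact: bigcupT_measurable.
    have tZ Z : trivIset setT (fun k => [set w : T | F k (Z ^~ w)]).
      move=> i j _ _ [w /= [Fi Fj]]; apply: (tF i j) => //.
      by exists (Z ^~ w).
    have [mFX mFY] : (forall k, measurable [set w | F k (X ^~ w)]) /\
        (forall k, measurable [set w | F k (Y ^~ w)]).
      by split=> k; have [] := HF k.
    split; [exact: mF|exact: mF|].
    have eX := prE P (measurableI _ _ mB (mF X mFX)); have eY := prE P (mF Y mFY).
    apply: EFin_inj; rewrite EFinM -eX -eY.
    rewrite !UZ setI_bigcupr !measure_bigcup//; last 2 first.
    - by move=> k _; exact: measurableI.
    - by apply: trivIset_setIl.
    rewrite -nneseriesZl//.
    apply: eq_eseriesr => k _; have [_ _ eF] := HF k.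
    have eX' := prE P (measurableI _ _ mB (mFX k)); have eY' := prE P (mFY k).
    have := congr1 EFin eF; rewrite EFinM -eX' -eY' => eP; exact: eP.
move=> A /= mA; apply: (lambda_system_subset dG lH GH) => //.
apply: sub_sigma_algebra2 mA => _ [i [b ->]]; exists i.+1 => z z' zz' /= <-.
by rewrite zz'.
Qed.

(** The space of paths is itself a measurable space on which the coordinates form
a process, so the measurability result for processes applies to it. *)
Lemma measurable_path_determined n Q : determined n Q -> measurable_path Q.
Proof.
move=> dQ.
have mcoord i : measurable_fun setT
    (fun z : g_sigma_algebraType [set A | exists (i : nat) (b : bool),
       A = [set x : nat -> bool | x i = b]] => z i).
  apply: (measurable_fun_bool true); rewrite setTI.
  by apply: sub_sigma_algebra; exists i, true.
by have := measurable_determined mcoord dQ; rewrite /measurable/=.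
Qed.

Lemma measurable_pathI A A' : measurable_path A -> measurable_path A' ->
  measurable_path (A `&` A').
Proof.
exact: (@measurableI _ (g_sigma_algebraType [set A | exists (i : nat) (b : bool),
       A = [set x : nat -> bool | x i = b]])).
Qed.

(** * Stationary processes and a criterion for ergodicity *)

Section frequency.
Context d (T : measurableType d) (R : realType) (P : probability T R).

(** Outside [F] the number of events that occur is [c], so the expectation over
[B] of that number is [c * pr B] up to what happens on [F], where both the number
and [c] are at most [N]. *)
Lemma frequency_bound (N c : nat) (E : nat -> set T) (B F : set T) :
    (c <= N)%N -> (forall t, measurable (E t)) -> measurable B -> measurable F ->
    (forall w, ~ F w -> \sum_(t < N) \1_(E t) w = c%:R :> R) ->
  `|\sum_(t < N) pr P (B `&` E t) - c%:R * pr P B| <= N%:R * pr P F.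
Proof.
move=> leqcN mE mB mF Ec.
have mBF : measurable (B `&` F) by exact: measurableI.
have mBC : measurable (B `&` ~` F) by apply: measurableI => //; exact: measurableC.
have -> : \sum_(t < N) pr P (B `&` E t) =
    \sum_(t < N) pr P ((B `&` F) `&` E t) + c%:R * pr P (B `&` ~` F).
  rewrite -(pr_count P (r := index_enum 'I_N) (Q := xpredT)
    (E := fun t : 'I_N => E t) mBC) => //.
    rewrite -big_split/=; apply: eq_bigr => t _.
    rewrite (@pr_splitI _ _ _ _ (B `&` E t) F)//; last exact: measurableI.
    by rewrite (setIAC B _ F) (setIAC B _ (~` F)).
  by move=> w [_ /Ec].
have S0 : 0 <= \sum_(t < N) pr P ((B `&` F) `&` E t).
  by apply: sumr_ge0 => t _; exact: pr_ge0.
have S1 : \sum_(t < N) pr P ((B `&` F) `&` E t) <= N%:R * pr P F.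
  rewrite mulrC mulr_natr -[X in _ <= _ *+ X]card_ord -sumr_const; apply: ler_sum => t _.
  apply: le_pr => //; last by move=> w [[]].
  exact: measurableI.
have C1 : c%:R * pr P (B `&` F) <= N%:R * pr P F.
  by apply: ler_pM => //; rewrite ?ler_nat ?pr_ge0//; apply: le_pr => // w [].
have C0 : 0 <= c%:R * pr P (B `&` F) by rewrite mulr_ge0 ?pr_ge0.
rewrite (pr_splitI P mB mF) mulrDr.
by rewrite ler_norml; apply/andP; split; lra.
Qed.

End frequency.

Lemma close_of_frequency (R : realFieldType) (n c f a b q eps : R) :
    0 < n -> 0 <= b -> b <= 1 -> f <= eps / 2 ->
    `|n * a - c * b| <= n * f -> `|n * q - c| <= n * f ->
  `|a - b * q| <= eps.
Proof.
move=> n0 b0 b1 feps ha hq.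
rewrite -(ler_pM2l n0) -[X in X * `|_|](gtr0_norm n0) -normrM.
have -> : n * (a - b * q) = (n * a - c * b) - b * (n * q - c) by ring.
apply: le_trans (ler_normB _ _) _; rewrite normrM (ger0_norm b0).
have : b * `|n * q - c| <= 1 * (n * f) by apply: ler_pM.
have : n * f <= n * (eps / 2) by rewrite ler_pM2l.
lra.
Qed.

Section stationary_processes.
Context (R : realType) (p : binary_process R).
Local Notation X := (fun i w => rv p i w).

Lemma measurable_rv i : measurable_fun setT (rv p i).
Proof. exact: measurable_funP. Qed.

Hypothesis sp : stationary p.

Lemma stationary_determined k n Q : determined n Q ->
  pr (law p) [set w | Q (fun i => rv p (k + i)%N w)] =
  pr (law p) [set w | Q (fun i => rv p i w)].
Proof.
move=> dQ; have mX := measurable_rv.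
rewrite -[[set w | Q (fun i => rv p (k + i)%N w)]]setTI -[[set w | Q (rv p ^~ w)]]setTI.
rewrite (pr_word_sum (X := fun i w => rv p (k + i)%N w) _ _ _ dQ)//.
rewrite (pr_word_sum (X := X) _ _ _ dQ)//; apply: eq_bigr => v _; rewrite !setTI.
by rewrite !word_eqE /pr sp.
Qed.

Lemma stationary_path k A : measurable_path A ->
  pr (law p) [set w | A (fun i => rv p (k + i)%N w)] =
  pr (law p) [set w | A (fun i => rv p i w)].
Proof.
move=> mA; have mX := measurable_rv.
have [||n Q dQ|_ _] := @path_law_ext _ _ _ (law p) (fun i w => rv p (k + i)%N w) X
  setT _ _ measurableT _ A mA => //.
  by rewrite setTI pr_setT mul1r (stationary_determined _ dQ).
by rewrite setTI pr_setT mul1r.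
Qed.

(** For an invariant [A], all the events [A] and [Q after t steps] have the same
probability, so [N * pr (A and Q)] is the expected number of [t < N] at which [Q]
occurs, restricted to [A]; likewise with the sure event in place of [A].  If that
number is nearly constant, [A] and [Q] are independent.  This extends to all
measurable [Q], in particular to [A] itself, so [pr A] is its own square. *)
Lemma ergodic_of_frequency :
    (forall n Q (eps : R), determined n Q -> 0 < eps ->
      exists N c F, [/\ (0 < N)%N, (c <= N)%N, measurable F, pr (law p) F <= eps &
        forall w, ~ F w ->
          \sum_(t < N) \1_[set w | Q (fun i => rv p (t + i)%N w)] w = c%:R :> R]) ->
  ergodic p.
Proof.
move=> freq A mA shA; have mX := measurable_rv.
have mXA : measurable [set w | A (fun i => rv p i w)].
  have [||n Q dQ|//] := @path_law_ext _ _ _ (law p) X X setT _ _ measurableT _ A mA => //.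
  by rewrite setTI pr_setT mul1r.
have shiftA t z : A (fun i => z (t + i)%N) <-> A z.
  have shA1 y : A (shift_path y) <-> A y by rewrite -{2}shA.
  by elim: t z => [//|t IH] z; exact: iff_trans (IH (shift_path z)) (shA1 z).
set A' := [set w | A (fun i => rv p i w)] in mXA.
have indep n Q : determined n Q ->
    pr (law p) (A' `&` [set w | Q (fun i => rv p i w)]) =
    pr (law p) A' * pr (law p) [set w | Q (fun i => rv p i w)].
  move=> dQ; apply/eqP; rewrite -subr_eq0 -normr_le0; apply/ler_addgt0Pl => eps eps0.
  rewrite addr0.
  have eps2 : 0 < eps / 2 by lra.
  have [N [c [F [N0 leqcN mF Feps Fc]]]] := freq n Q (eps / 2) dQ eps2.
  pose E t := [set w | Q (fun i => rv p (t + i)%N w)].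
  have mE t : measurable (E t).
    exact: (@measurable_determined _ _ (fun i w => rv p (t + i)%N w) _ _ _ dQ).
  have sumE B : measurable_path B -> (forall t z, B (fun i => z (t + i)%N) <-> B z) ->
      \sum_(t < N) pr (law p) ([set w | B (fun i => rv p i w)] `&` E t) =
      N%:R * pr (law p) ([set w | B (fun i => rv p i w)] `&` [set w | Q (fun i => rv p i w)]).
    move=> mB shB; rewrite (eq_bigr (fun=> pr (law p) ([set w | B (fun i => rv p i w)] `&`
       [set w | Q (fun i => rv p i w)]))) => [|t _].
      by rewrite sumr_const card_ord mulr_natl.
    have := stationary_path t (measurable_pathI mB (measurable_path_determined dQ)).
    move=> <-; congr pr; apply/seteqP; split => w /=.
      by move=> [Bw Qw]; split => //; apply/(shB t (rv p ^~ w)).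
    by move=> [/(shB t (rv p ^~ w))].
  apply: (@close_of_frequency _ N%:R c%:R (pr (law p) F)) => //.
  - by rewrite ltr0n.
  - exact: pr_ge0.
  - exact: pr_le1.
  - by rewrite -(sumE A mA shiftA); exact: frequency_bound.
  - have := frequency_bound (law p) leqcN mE measurableT mF Fc.
    rewrite pr_setT mulr1.
    rewrite (sumE setT (measurable_path_determined (n := 0) _))//.
    by rewrite setTI.
have [_ _ e] := path_law_ext mX mX mXA indep mA.
have {e} : pr (law p) A' * (pr (law p) A' - 1) = 0.
  by move: e; rewrite -/A' setIid mulrBr mulr1 => <-; rewrite subrr.
move=> /eqP; rewrite mulf_eq0 subr_eq0 => /orP[] /eqP A01; [left|right];
  by rewrite -[_ @^-1` _]/A' prE// A01.
Qed.

End stationary_processes.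

(** * Periodic sequences with a uniform phase *)

Section make_process.
Context d (T : measurableType d) (R : realType) (P : probability T R).
Context (X : nat -> T -> bool) (mX : forall i, measurable_fun setT (X i)).

Definition make_process : binary_process R :=
  @BinaryProcess R d T P (fun i => mfun_Sub (mem_set (mX i))).

End make_process.

Lemma sum_periodic (f : nat -> nat) N k : (forall t, f (t + N)%N = f t) ->
  (\sum_(r < N) f (r + k) = \sum_(r < N) f r)%N.
Proof.
case: N => [|N] perf; first by rewrite !big_ord0.
elim: k => [|k <-]; first by apply: eq_bigr => r _; rewrite addn0.
rewrite [RHS]big_ord_recl [LHS]big_ord_recr/= addnC add0n; congr (_ + _)%N.
  by rewrite -addSnnS addnC perf.
by apply: eq_bigr => r _; rewrite /bump/= add1n addSnnS.
Qed.

Lemma periodic_frequency (y : nat -> bool) N (Q : set (nat -> bool)) r :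
    (forall t, y (t + N)%N = y t) ->
  (\sum_(t < N) `[< Q (fun i => y (r + (t + i))) >] =
   \sum_(t < N) `[< Q (fun i => y (t + i)) >])%N.
Proof.
move=> pery; rewrite -(sum_periodic (f := fun t => `[< Q (fun i => y (t + i)%N) >] : nat) r).
  by apply: eq_bigr => t _; under eq_fun do rewrite addnA [(r + t)%N]addnC.
by move=> t; under eq_fun do rewrite addnAC pery.
Qed.

Section phase.
Context d (T : measurableType d) (R : realType) (P : probability T R).
Context (N : nat) (phase : T -> nat).

Definition uniform_phase : Prop :=
  [/\ forall r, measurable [set w | phase w = r],
      forall w, (phase w < N)%N &
      forall r, (r < N)%N -> pr P [set w | phase w = r] = N%:R^-1].

Hypothesis uphase : uniform_phase.

Lemma pr_phase (S : pred nat) :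
  pr P [set w | S (phase w)] = (\sum_(r < N) S r)%N%:R / N%:R.
Proof.
have [mphase ltphaseN prphase] := uphase.
have mf (r : 'I_N) : measurable [set w | Ordinal (ltphaseN w) = r].
  rewrite (_ : mkset _ = [set w | phase w = r])//.
  by apply/seteqP; split => w /= => [<-//|er]; exact: val_inj.
have := pr_partition P (f := fun w => Ordinal (ltphaseN w)) (fun r : 'I_N => S r)
  measurableT mf.
rewrite setTI/= => ->.
rewrite big_mkcond natr_sum mulr_suml; apply: eq_bigr => r _.
rewrite setTI (_ : [set w | _] = [set w | phase w = r]).
  by rewrite prphase//; case: (S r); rewrite ?mul1r ?mul0r.
by apply/seteqP; split => w /= => [<-//|er]; exact: val_inj.
Qed.

Lemma measurable_phase (S : set nat) : measurable [set w | S (phase w)].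
Proof. by apply: measurable_countable_fun; case: uphase. Qed.

Section periodic.
Variable y : nat -> bool.
Hypothesis pery : forall t, y (t + N)%N = y t.

Lemma measurable_periodic i : measurable_fun setT (fun w => y (phase w + i)%N).
Proof.
apply: (measurable_fun_bool true); rewrite setTI.
exact: (measurable_phase (fun r => y (r + i)%N)).
Qed.

Definition periodic_process : binary_process R := make_process P measurable_periodic.

Lemma pr_periodic (Q : set (nat -> bool)) :
  pr P [set w | Q (fun i => y (phase w + i)%N)] =
  (\sum_(r < N) `[< Q (fun i => y (r + i)) >])%N%:R / N%:R.
Proof.
rewrite -(pr_phase (fun r => `[< Q (fun i => y (r + i)%N) >])); congr pr.
by apply/seteqP; split => w /= /asboolP.
Qed.

Lemma stationary_periodic : stationary periodic_process.
Proof.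
move=> k n x.
have mA j := measurable_agree (@measurable_rv _ periodic_process) n j x.
rewrite (prE _ (mA k)) (prE _ (mA 0)); congr EFin.
rewrite -[LHS]/(pr P [set w | [set z : nat -> bool | forall i, (i < n)%N -> z (k + i)%N = x i]
  (fun i => y (phase w + i)%N)]).
rewrite -[RHS]/(pr P [set w | [set z : nat -> bool | forall i, (i < n)%N -> z i = x i]
  (fun i => y (phase w + i)%N)]).
rewrite !pr_periodic -[in RHS](@periodic_frequency _ _ _ k pery).
congr (_%:R / _); apply: eq_bigr => r _ /=.
by congr nat_of_bool; apply: asbool_equiv_eq; split => h i /h; rewrite addnCA.
Qed.

Lemma ergodic_periodic : ergodic periodic_process.
Proof.
apply: ergodic_of_frequency => [|n Q eps dQ eps0]; first exact: stationary_periodic.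
exists N, (\sum_(t < N) `[< Q (fun i => y (t + i)) >])%N, set0; split => //.
- by have [_ /(_ point)] := uphase; lia.
- by rewrite -[leqRHS]card_ord -sum1_card; apply: leq_sum => t _; case: asbool.
- by rewrite pr_set0 ltW.
- move=> w _; rewrite -(@periodic_frequency _ _ _ (phase w) pery) natr_sum.
  apply: eq_bigr => t _; rewrite indicE; congr (nat_of_bool _)%:R.
Qed.

(** The symbol one period ago is among the last [N] ones and equals the next
symbol, so both conditional probabilities are 0 or 1 and agree. *)
Lemma markov_periodic : markov_of_order periodic_process N.
Proof.
move=> n x leqNn Pn.
have Xper i w : rv periodic_process (i + N)%N w = rv periodic_process i w.
  by rewrite /= addnA pery.
have agree_last w : agree (p := periodic_process) x (n - N) n w ->
    agree x n n.+1 w <-> x (n - N)%N = x n.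
  move=> Bw; have N0 : (0 < N)%N by have [_ /(_ point)] := uphase; lia.
  have <- : rv periodic_process n w = x (n - N)%N.
    by rewrite -{1}(subnK leqNn) Xper Bw//; lia.
  split=> [/(_ n)|e m]; first by apply; lia.
  by move=> lt; have -> : m = n by lia.
have mB i j : measurable (agree (p := periodic_process) x i j).
  rewrite (_ : agree _ _ _ = [set w | forall m, (m < j - i)%N ->
      rv periodic_process (i + m)%N w = x (i + m)%N]).
    exact: (measurable_agree (@measurable_rv _ periodic_process)).
  apply/seteqP; split => w /= h m lt; first by apply: h; apply/andP; lia.
  have [leim ltmj] := andP lt.
  by have := h (m - i)%N; rewrite subnKC//; apply; lia.
have sub : agree (p := periodic_process) x 0 n `<=` agree x (n - N) n.
  by move=> w h m lt; apply: h; lia.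
have cond B : measurable B -> (0 < law periodic_process B)%E ->
    B `<=` agree (p := periodic_process) x (n - N) n ->
    cond_prob (law periodic_process) (agree x n n.+1) B = (x (n - N)%N == x n)%:R.
  move=> mB' B0 subB; rewrite /cond_prob; case: eqP => e.
    rewrite (_ : _ `&` B = B) ?divff// ?gt_eqF//.
      by move: B0; rewrite prE.
    by apply/setIidPr => w Bw; apply/(agree_last w (subB _ Bw)).
  rewrite (_ : _ `&` B = set0) ?measure0 ?mul0r//.
  by rewrite -subset0 => w [Aw Bw]; apply: e; apply/(agree_last w (subB _ Bw)).
rewrite !cond//.
by apply: lt_le_trans Pn _; apply: le_measure; rewrite ?inE.
Qed.

Lemma finite_order_markov_periodic : finite_order_markov periodic_process.
Proof.
split; last by exists N; exact: markov_periodic.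
by split; [exact: stationary_periodic|exact: ergodic_periodic].
Qed.

End periodic.
End phase.

(** * Recurrent aperiodic processes have no finite order *)

(** Pigeonhole on the iterates of [F] as a whole, so that neither the delay nor
the period depends on the starting point [u]. *)
Lemma iter_eventually_periodic (V : finType) (F : V -> V) :
  exists a D, (0 < D)%N /\ forall M u, iter (a + D * M) F u = iter a F u.
Proof.
pose G j : {ffun V -> V} := [ffun u => iter j F u].
have [a [b [ltab Gab]]] : exists a b, (a < b)%N /\ G a = G b.
  apply: contrapT => nG.
  have injG : injective (fun j : 'I_#|{ffun V -> V}|.+1 => G j).
    move=> i j Gij; apply: val_inj => /=.
    have [ltij|ltji|//] := ltngtP i j; case: nG; first by exists i, j.
    by exists j, i.
  by have := leq_card _ injG; rewrite card_ord ltnn.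
exists a, (b - a)%N; split=> [|M u]; first by rewrite subn_gt0.
elim: M => [|M IH]; first by rewrite muln0 addn0.
rewrite mulnS addnA subnKC ?(ltnW ltab)// addnC iterD.
have := congr1 (fun g : {ffun V -> V} => g u) Gab; rewrite !ffunE => <-.
by rewrite -iterD addnC IH.
Qed.

Section not_markov.
Context (R : realType) (p : binary_process R).
Hypothesis sp : stationary p.
Local Notation X := (rv p).
Local Notation pr := (pr (law p)).

Lemma measurable_rv_determined n Q : determined n Q ->
  measurable [set w | Q (fun i => X i w)].
Proof. exact: (measurable_determined (@measurable_rv _ p)). Qed.

(** The Markov property conditions on a complete past; summing over all the pasts
of an event [Q] that prescribe the same last [k] symbols, the conditional
probability of the next symbol given [Q] is still that given those symbols.
Multiplying out the denominators covers null conditions as well. *)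
Lemma markov_determined k N (x : nat -> bool) b (Q : set (nat -> bool)) :
    markov_of_order p k -> determined (N + k) Q ->
    (forall z, Q z -> forall i, (i < k)%N -> z (N + i)%N = x i) ->
  pr ([set w | X (N + k)%N w = b] `&` [set w | Q (X ^~ w)]) *
    pr [set w | forall i, (i < k)%N -> X i w = x i] =
  pr [set w | X k w = b /\ forall i, (i < k)%N -> X i w = x i] *
    pr [set w | Q (X ^~ w)].
Proof.
move=> mk dQ Qx; have mX := @measurable_rv _ p.
have mb : measurable [set w | X (N + k)%N w = b].
  exact: (measurable_coord (X := X)).
have dU : determined k [set z | forall i, (i < k)%N -> z i = x i].
  by move=> z z' zz' /= h i ltik; rewrite -zz'// h.
have dUb : determined k.+1 [set z | z k = b /\ forall i, (i < k)%N -> z i = x i].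
  move=> z z' zz' /= [<- h]; split=> [|i ltik]; first by rewrite zz'.
  by rewrite -zz' ?h// ltnS ltnW.
set U := [set w | forall i, _]; set Ub := [set w | X k w = b /\ _].
have mU : measurable U by exact: (measurable_rv_determined dU).
have mUb : measurable Ub by exact: (measurable_rv_determined dUb).
have [U0|U0] := eqVneq (pr U) 0.
  rewrite U0 mulr0 (_ : pr Ub = 0) ?mul0r//; apply/eqP.
  by rewrite eq_le pr_ge0 -U0 le_pr// => w [].
rewrite (pr_word_sum (law p) mX mb dQ) -[[set w | Q _]]setTI.
rewrite (pr_word_sum (law p) mX measurableT dQ) mulr_suml mulr_sumr.
apply: eq_bigr => v /asboolP Qv; rewrite setTI.
pose z i := if (i < N + k)%N then extend v i else b.
have zv : agree z 0 (N + k) = [set w | word X (N + k) w = v].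
  rewrite word_eqE; apply/seteqP; split => w /= h i lti.
    by rewrite (h i)// /z lti.
  by move: lti => /= lti; rewrite h// /z lti.
have zb : agree z (N + k) (N + k).+1 = [set w | X (N + k)%N w = b].
  apply/seteqP; split => w /= h.
    by rewrite h ?leqnn ?ltnSn// /z ltnn.
  move=> i lti; have -> : i = (N + k)%N by lia.
  by rewrite /z ltnn.
have zU : agree z (N + k - k) (N + k) =
    [set w | forall i, (i < k)%N -> X (N + i)%N w = x i].
  rewrite addnK; apply/seteqP; split => w /= h i lti.
    by rewrite h ?leq_addr ?ltn_add2l// /z ltn_add2l lti (Qx _ Qv).
  have lei : (N <= i)%N by case/andP: lti.
  rewrite -(subnKC lei) h; last by lia.
  by rewrite /z subnKC// (andP lti).2 -(Qx _ Qv) ?subnKC//; lia.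
have mv : measurable [set w | word X (N + k) w = v] by exact: measurable_word.
have [v0|v0] := eqVneq (pr [set w | word X (N + k) w = v]) 0.
  rewrite v0 mulr0 (_ : pr (_ `&` _) = 0) ?mul0r//; apply/eqP.
  by rewrite eq_le pr_ge0 -v0 le_pr//; exact: measurableI.
have := mk (N + k)%N z (leq_addl _ _).
rewrite zv zb zU /cond_prob prE// lte_fin lt_neqAle eq_sym v0 pr_ge0/= => /(_ isT).
have -> : fine (law p [set w | forall i, (i < k)%N -> X (N + i)%N w = x i]) = pr U.
  exact: (stationary_determined sp N dU).
have -> : fine (law p ([set w | X (N + k)%N w = b] `&`
    [set w | forall i, (i < k)%N -> X (N + i)%N w = x i])) = pr Ub.
  exact: (stationary_determined sp N dUb).
by move=> /eqP; rewrite eqr_div// => /eqP.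
Qed.

(** After the word [x] followed by [b], a late return brings the process back to
the same word followed by the same [b], up to a small error.  But the Markov
property lets it forget what followed [x] the first time: after the return it
continues with [~~ b] with its conditional probability given [x], which therefore
vanishes. *)
Lemma markov_deterministic k (x : nat -> bool) b :
    (forall k' (eps : R), 0 < eps -> exists2 N, (0 < N)%N &
       pr [set w | ~ forall i, (i < k')%N -> X (i + N)%N w = X i w] <= eps) ->
    markov_of_order p k ->
  0 < pr [set w | X k w = b /\ forall i, (i < k)%N -> X i w = x i] ->
  pr [set w | X k w = ~~ b /\ forall i, (i < k)%N -> X i w = x i] = 0.
Proof.
move=> recurrent mk.
have dUb c : determined k.+1 [set z | z k = c /\ forall i, (i < k)%N -> z i = x i].
  move=> z z' zz' /= [<- h]; split=> [|i ltik]; first by rewrite zz'.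
  by rewrite -zz' ?h// ltnS ltnW.
have dU : determined k [set z | forall i, (i < k)%N -> z i = x i].
  by move=> z z' zz' /= h i ltik; rewrite -zz'// h.
have mU := measurable_rv_determined dU.
have mUb c : measurable [set w | X k w = c /\ forall i, (i < k)%N -> X i w = x i].
  exact: (measurable_rv_determined (dUb c)).
set a := pr _; set a' := pr _ => a0; apply/eqP; rewrite eq_le pr_ge0 andbT leNgt.
apply/negP => a'0.
pose U := [set w | forall i, (i < k)%N -> X i w = x i].
have {}mU : measurable U by exact: mU.
have U1 : pr U <= 1 by exact: pr_le1.
have a'U : a' <= pr U by apply: le_pr => // w [].
(* Any [eps < a * a' / (pr U + a')] would do, and [pr U + a' <= 2]. *)
have [|N N0 mis] := @recurrent k.+1 (a * a' / 4).
  by rewrite divr_gt0// mulr_gt0.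
pose Q : set (nat -> bool) := [set z | (z k = b /\ forall i, (i < k)%N -> z i = x i) /\
  forall i, (i < k)%N -> z (N + i)%N = x i].
have dQ : determined (N + k) Q.
  move=> z z' zz' [[zk zx] zN]; split; [split|].
  - by rewrite -zz'//; lia.
  - by move=> i lti; rewrite -zz' ?zx//; lia.
  - by move=> i lti; rewrite -zz' ?zN//; lia.
have mQ : measurable [set w | Q (X ^~ w)] by exact: (measurable_rv_determined dQ).
have dmis : determined (k.+1 + N) [set z | ~ forall i, (i < k.+1)%N -> z (i + N)%N = z i].
  move=> z z' zz' /= h h'; apply: h => i lti; rewrite !zz' ?h'//; lia.
have mmis : measurable [set w | ~ forall i, (i < k.+1)%N -> X (i + N)%N w = X i w].
  exact: (measurable_rv_determined dmis).
have mb : measurable [set w | X (N + k)%N w = ~~ b].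
  exact: (measurable_coord (X := X)).
have := markov_determined (~~ b) mk dQ (fun z => @proj2 _ _).
rewrite -/a' -/U.
have : pr ([set w | X (N + k)%N w = ~~ b] `&` [set w | Q (X ^~ w)]) <= a * a' / 4.
  apply: le_trans mis; apply: le_pr => //; first exact: measurableI.
  move=> w [/= XN [[Xk _] _]] /(_ k (leqnn _)); rewrite addnC XN Xk.
  by move=> e; move: (addbN b b); rewrite e addbb.
have : a <= pr [set w | Q (X ^~ w)] + a * a' / 4.
  apply: le_trans (lerD (lexx _) mis); apply: le_trans (le_prU _ _ _) => //.
  apply: le_pr => //; first exact: measurableU.
  move=> w /= Uw; have [ret|] := pselect (forall i, (i < k.+1)%N -> X (i + N)%N w = X i w).
    left; split=> // i lti; rewrite addnC ret; last by lia.
    by case: Uw => _ ->.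
  by right.
set q := pr [set w | Q _]; set e := pr _ => aq eU eq.
have q0 : 0 <= q by exact: pr_ge0.
have a'1 : a' <= 1 by lra.
have e0 : 0 <= e by exact: pr_ge0.
nra.
Qed.

(** Almost surely each word of [k] symbols is a fixed function [F] of the
preceding one.  [F] acts on a finite set, so its orbits become periodic after a
delay that stationarity removes.  All multiples of [D] appear because, to be
refuted, a period must be replaced by a suitable multiple. *)
Lemma deterministic_periodic k :
    (forall (x : nat -> bool) b,
     0 < pr [set w | X k w = b /\ forall i, (i < k)%N -> X i w = x i] ->
     pr [set w | X k w = ~~ b /\ forall i, (i < k)%N -> X i w = x i] = 0) ->
  exists2 D, (0 < D)%N & forall M, pr [set w | X 0 w <> X (D * M) w] = 0.
Proof.
move=> det; have mX := @measurable_rv _ p.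
have /choice[f fP] (u : k.-tuple bool) :
    exists b, pr [set w | X k w = ~~ b /\ word X k w = u] = 0.
  have eU b : [set w | X k w = b /\ word X k w = u] =
      [set w | X k w = b /\ forall i, (i < k)%N -> X i w = extend u i].
    by apply/seteqP; split => w /= [-> /(word_eqP X)].
  have [u0|u0] := eqVneq (pr [set w | X k w = true /\ word X k w = u]) 0.
    by exists false.
  exists true; rewrite eU; apply: det; rewrite -eU lt_neqAle eq_sym u0.
  exact: pr_ge0.
pose st j w : k.-tuple bool := word (fun i => X (j + i)%N) k w.
pose F (u : k.-tuple bool) : k.-tuple bool :=
  [tuple if (i.+1 < k)%N then extend u i.+1 else f u | i < k].
pose Z j := [set w | X (j + k)%N w <> f (st j w)].
have dZ : determined k.+1 [set z | z k <> f [tuple z i | i < k]].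
  move=> z z' zz' /=; rewrite zz'// (_ : [tuple z i | i < k] = [tuple z' i | i < k])//.
  by apply: eq_from_tnth => i; rewrite !tnth_mktuple zz'// ltnS ltnW.
have mZ j : measurable (Z j).
  exact: (@measurable_determined _ _ (fun i => X (j + i)%N) _ _ _ dZ).
have Z0 j : pr (Z j) = 0.
  rewrite (_ : pr (Z j) = pr (Z 0)); last exact: (stationary_determined sp j dZ).
  have mw v : measurable [set w | st 0 w = v].
    exact: (measurable_word (X := fun i => X (0 + i)%N)).
  have := pr_partition (law p) xpredT (mZ 0) mw.
  rewrite (_ : _ `&` _ = Z 0)//; last by apply/seteqP; split=> w //= [].
  move=> ->; apply: big1 => v _; apply/eqP; rewrite eq_le pr_ge0 andbT.
  rewrite -(fP v); apply: le_pr.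
  - exact: measurableI.
  - exact: (measurableI _ _ (measurable_coord mX k (~~ f v)) (measurable_word mX v)).
  - move=> w [/= + stv]; rewrite /Z/= stv => Xf; split; last exact: stv.
    by move: Xf; rewrite /= add0n; case: (X k w) (f v) => -[].
have stS j w : ~ Z j w -> st j.+1 w = F (st j w).
  move=> /contrapT Xf; apply: eq_from_tnth => i; rewrite !tnth_mktuple.
  case: ltnP => [lti|lei]; first by rewrite extend_word// addSnnS.
  rewrite -Xf; congr (X _ w); have := ltn_ord i; lia.
have [a [D [D0 FD]]] := iter_eventually_periodic F.
exists D => // M.
have st_iter j w : (forall i, (i < j)%N -> ~ Z i w) -> st j w = iter j F (st 0 w).
  elim: j => [//|j IH] nZ; rewrite iterS -IH ?stS//; first exact: nZ.
  by move=> i lti; apply: nZ; rewrite ltnS ltnW.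
have dD : determined (D * M).+1 [set z : nat -> bool | z 0 <> z (D * M)%N].
  by move=> z z' zz' /=; rewrite !zz'.
have := stationary_determined sp (a + k) dD => /= <-.
apply/eqP; rewrite eq_le pr_ge0 andbT.
pose n := (a + D * M).+1.
have -> : 0 = \sum_(j < n) pr (Z j) by rewrite big1.
apply: le_trans (pr_bigcup_ord _ _ mZ); apply: le_pr.
- exact: (@measurable_determined _ _ (fun i => X (a + k + i)%N) _ _ _ dD).
- exact: bigcup_measurable.
move=> w /= XX; apply: contrapT => nZ; apply: XX.
have nZ' i : (i < n)%N -> ~ Z i w by move=> lti Ziw; apply: nZ; exists i.
rewrite addn0 addnAC.
have -> : X (a + k)%N w = f (st a w) by apply: contrapT; apply: nZ'; rewrite /n; lia.
have -> : X (a + D * M + k)%N w = f (st (a + D * M)%N w).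
  by apply: contrapT; apply: nZ'; rewrite /n; lia.
suff -> : st (a + D * M)%N w = st a w by [].
have eb : st (a + D * M)%N w = iter (a + D * M) F (st 0 w).
  by apply: st_iter => i lti; apply: nZ'; exact: ltnW.
have ea : st a w = iter a F (st 0 w).
  apply: st_iter => i lti; apply: nZ'.
  by rewrite /n ltnS (leq_trans (ltnW lti))// leq_addr.
by rewrite eb FD -ea.
Qed.

End not_markov.

Lemma not_markov (R : realType) (p : binary_process R) :
    stationary p ->
    (forall k (eps : R), 0 < eps -> exists2 N, (0 < N)%N &
      pr (law p) [set w | ~ forall i, (i < k)%N -> rv p (i + N)%N w = rv p i w] <= eps) ->
    (forall D, (0 < D)%N ->
      exists M, 0 < pr (law p) [set w | rv p 0 w <> rv p (D * M)%N w]) ->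
  forall k, ~ markov_of_order p k.
Proof.
move=> sp rec aper k mk.
have [D D0 per] := deterministic_periodic sp
  (fun x b => @markov_deterministic _ _ sp k x b rec mk).
by have [M] := aper D D0; rewrite per ltxx.
Qed.

(** * Compatible uniform phases *)

Lemma truncn_ge_natS (R : archiRealDomainType) (x : R) n :
  (0 < n)%N -> (n <= Num.truncn x)%N = (n%:R <= x).
Proof. by case: n => // n _; rewrite truncn_gt_nat. Qed.

Lemma truncn_mulr_divn (R : archiRealFieldType) (x : R) L : (0 < L)%N ->
  (Num.truncn (x * L%:R) %/ L = Num.truncn x)%N.
Proof.
move=> L0; suff e n : (n <= Num.truncn (x * L%:R) %/ L)%N = (n <= Num.truncn x)%N.
  by apply/eqP; rewrite eqn_leq e leqnn -e leqnn.
case: n => [|n]; first by rewrite !leq0n.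
rewrite leq_divRL// !truncn_ge_natS ?muln_gt0// natrM ler_pM2r// ltr0n//.
Qed.

Section odometer.
Variable L : nat -> nat.
Hypothesis L_gt0 : forall j, (0 < L j)%N.

Definition period (m : nat) : nat := (\prod_(j < m) L j)%N.

Lemma periodS m : period m.+1 = (period m * L m)%N.
Proof. by rewrite /period big_ord_recr. Qed.

Lemma period_gt0 m : (0 < period m)%N.
Proof. by rewrite prodn_gt0. Qed.

(** The mixed-radix digits of [a], written back with the most significant one
becoming the least significant.  Refining an interval of length
[1 / period m] into [L m] pieces adds a least significant digit to [a]; after
reversal it is a most significant one, so the residue modulo [period m] is
kept. *)
Fixpoint reverse_digits (m a : nat) : nat :=
  if m is m'.+1 then (reverse_digits m' (a %/ L m') + period m' * (a %% L m'))%N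
  else 0.

Fixpoint unreverse_digits (m r : nat) : nat :=
  if m is m'.+1 then (unreverse_digits m' (r %% period m') * L m' + r %/ period m')%N
  else 0.

Lemma ltn_reverse_digits m a : (reverse_digits m a < period m)%N.
Proof.
elim: m a => [|m IH] a /=; first by rewrite /period big_ord0.
rewrite periodS; apply: (@leq_trans (period m * (a %% L m).+1)).
  by rewrite mulnS ltn_add2r.
by rewrite leq_pmul2l ?period_gt0// ltn_pmod.
Qed.

Lemma ltn_unreverse_digits m r : (r < period m)%N ->
  (unreverse_digits m r < period m)%N.
Proof.
elim: m r => [|m IH] r /=; first by rewrite /period big_ord0.
rewrite periodS => ltr.
have ltq : (r %/ period m < L m)%N by rewrite ltn_divLR ?period_gt0// mulnC.
apply: (@leq_trans ((unreverse_digits m (r %% period m)).+1 * L m)).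
  by rewrite mulSn addnC ltn_add2r.
by rewrite leq_mul2r IH ?orbT// ltn_pmod ?period_gt0.
Qed.

Lemma unreverse_digitsK m r : (r < period m)%N ->
  reverse_digits m (unreverse_digits m r) = r.
Proof.
elim: m r => [|m IH] r /=; first by rewrite /period big_ord0; case: r.
rewrite periodS => ltr.
have ltq : (r %/ period m < L m)%N by rewrite ltn_divLR ?period_gt0// mulnC.
rewrite divnMDl ?L_gt0// (divn_small ltq) addn0 modnMDl (modn_small ltq).
rewrite IH ?ltn_pmod ?period_gt0//.
by rewrite addnC mulnC -divn_eq.
Qed.

Context (R : realType).

Definition phase (m : nat) (u : R) : nat :=
  reverse_digits m (Num.truncn (u * (period m)%:R)).

Lemma phase_mod m u : (phase m.+1 u %% period m = phase m u)%N.
Proof.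
rewrite /phase/= addnC mulnC modnMDl modn_small ?ltn_reverse_digits//.
by rewrite periodS natrM mulrA truncn_mulr_divn.
Qed.

Lemma measurable_truncn (N : nat) a :
  measurable [set u : measurableTypeR R | Num.truncn (u * N%:R) = a].
Proof.
have mN : measurable_fun setT (fun u : measurableTypeR R => u * N%:R).
  exact: measurable_funM.
have mge b : measurable [set u : measurableTypeR R | (b <= Num.truncn (u * N%:R))%N].
  case: b => [|b]; first by rewrite (_ : mkset _ = setT)// -subTset.
  under eq_set do rewrite truncn_gt_nat.
  rewrite -[X in measurable X]setTI.
  have := mN measurableT `[b.+1%:R, +oo[%classic (measurable_itv _).
  by congr measurable; apply/seteqP; split => u /=; rewrite in_itv/= andbT.
rewrite (_ : mkset _ = [set u : measurableTypeR R | (a <= Num.truncn (u * N%:R))%N]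
    `\` [set u : measurableTypeR R | (a.+1 <= Num.truncn (u * N%:R))%N]).
  exact: measurableD.
apply/seteqP; split => u /=; first by move=> ->; rewrite leqnn ltnn.
by move=> [h1 /negP]; rewrite -leqNgt => h2; apply/eqP; rewrite eqn_leq h1 h2.
Qed.

Lemma measurable_phase_fiber m r :
  measurable [set u : measurableTypeR R | phase m u = r].
Proof.
exact: (measurable_countable_fun [set a | reverse_digits m a = r]
  (@measurable_truncn (period m))).
Qed.

Local Notation U := (uniform_prob (@ltr01 R)).

Lemma pr_uniform_itv (a b : R) : 0 <= a -> a <= b -> b <= 1 ->
  pr U `[a, b[%classic = b - a.
Proof.
move=> a0 ab b1; rewrite /pr -[b - a]/(fine (b - a)%:E); congr fine.
transitivity (uniform_prob (@ltr01 R) `[a, b[%classic); first by [].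
rewrite /uniform_prob.
rewrite (eq_integral (fun=> 1%:E)); last first.
  move=> x; rewrite inE/= in_itv/= /uniform_pdf => /andP[ax xb].
  by rewrite (le_trans a0 ax) (le_trans (ltW xb) b1) subr0 invr1.
rewrite integral_cst//= mul1e lebesgue_measure_itv/= lte_fin.
case: ltP => [_|ba]; first by rewrite EFinB.
by have -> : b = a by [apply/le_anti/andP]; rewrite subrr.
Qed.

(** Each residue contains an interval of length [1 / period m]; as there are
[period m] residues and the total mass is 1, these bounds are equalities. *)
Lemma uniform_phase_phase m : uniform_phase U (period m) (phase m).
Proof.
split; first exact: measurable_phase_fiber.
  by move=> u; exact: ltn_reverse_digits.
have N0 : 0 < (period m)%:R :> R by rewrite ltr0n period_gt0.
have ge r : (r < period m)%N -> (period m)%:R^-1 <= pr U [set w | phase m w = r].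
  move=> ltr; pose s := unreverse_digits m r.
  have lts : (s < period m)%N by exact: ltn_unreverse_digits.
  have -> : (period m)%:R^-1 = pr U `[s%:R / (period m)%:R, s.+1%:R / (period m)%:R[%classic.
    rewrite pr_uniform_itv ?divr_ge0//=.
    - by rewrite -mulrBl -natrB// subSnn mul1r.
    - by rewrite ler_pM2r ?invr_gt0// ler_nat.
    - by rewrite ler_pdivrMr// mul1r ler_nat.
  apply: le_pr => //; first exact: measurable_phase_fiber.
  move=> u /=; rewrite in_itv/= ler_pdivrMr// ltr_pdivlMr// => us.
  by rewrite /phase (truncn_def us) unreverse_digitsK.
have mf (r : 'I_(period m)) : measurable [set u : measurableTypeR R |
    Ordinal (ltn_reverse_digits m (Num.truncn (u * (period m)%:R))) = r].
  rewrite (_ : mkset _ = [set u | phase m u = r]); first exact: measurable_phase_fiber.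
  by apply/seteqP; split => u /= => [<-//|er]; exact: val_inj.
have sum1 : \sum_(r < period m) (pr U [set u | phase m u = r] - (period m)%:R^-1) = 0.
  rewrite sumrB sumr_const card_ord -[_ *+ _]mulr_natr mulVf ?gt_eqF//.
  have /esym := pr_partition U xpredT measurableT mf.
  rewrite [setT `&` _](_ : _ = setT); last by apply/seteqP; split.
  rewrite pr_setT => S1; apply/eqP; rewrite subr_eq0; apply/eqP.
  apply: etrans S1; apply: eq_bigr => r _; rewrite setTI.
  congr (pr U _); apply/seteqP; split => u /= => [er|<-//].
  exact: val_inj.
move=> r ltr; apply/eqP; rewrite -subr_eq0; apply/eqP.
apply: (psumr_eq0P _ sum1 (i := Ordinal ltr)) => // i _.
by rewrite subr_ge0 ge.
Qed.

End odometer.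

(** * The Toeplitz process *)

Section toeplitz.
Variable L : nat -> nat.
Hypothesis L_gt0 : forall j, (0 < L j)%N.
Local Notation period := (period L).

Definition toeplitz (m t : nat) : bool :=
  odd (\sum_(j < m) (period j.+1 %| t)%N).

Lemma dvdn_period j m : (j <= m)%N -> (period j %| period m)%N.
Proof.
move=> /subnKC <-; elim: (m - j)%N => [|k IH]; first by rewrite addn0.
by rewrite addnS periodS dvdn_mulr.
Qed.

Lemma toeplitz_dvdn m t t' : (period m %| t')%N ->
  toeplitz m (t' + t) = toeplitz m t.
Proof.
move=> dvt'; congr odd; apply: eq_bigr => j _; rewrite dvdn_addr//.
by apply: dvdn_trans dvt'; exact: dvdn_period.
Qed.

Lemma toeplitz_periodic m t : toeplitz m (t + period m) = toeplitz m t.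
Proof. by rewrite addnC toeplitz_dvdn. Qed.

Context (R : realType).
Local Notation phase := (phase L).
Local Notation U := (uniform_prob (@ltr01 R)).
Local Notation T := (measurableTypeR R).

(** The event that the symbol at time [i] is flipped from stage [j] to stage
[j.+1]. *)
Definition toggle j i : set T := [set u | (period j.+1 %| phase j.+1 u + i)%N].

Definition approx m i (u : T) : bool := toeplitz m (phase m u + i).

Lemma approxS m i u : approx m.+1 i u = approx m i u (+) (u \in toggle m i).
Proof.
rewrite /approx/toeplitz big_ord_recr/= oddD oddb; congr (_ (+) _).
  rewrite -/(toeplitz m (phase m.+1 u + i)) (divn_eq (phase m.+1 u) (period m)).
  by rewrite phase_mod// -addnA toeplitz_dvdn// dvdn_mull.
by apply/idP/idP; rewrite inE.
Qed.

Lemma measurable_toggle j i : measurable (toggle j i).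
Proof.
exact: (measurable_phase (uniform_phase_phase L_gt0 R j.+1)
  [set r | (period j.+1 %| r + i)%N]).
Qed.

(** Exactly one phase out of [period j.+1] is opposite to [i]. *)
Lemma pr_toggle j i : pr U (toggle j i) = (period j.+1)%:R^-1.
Proof.
have uph := uniform_phase_phase L_gt0 R j.+1.
rewrite (pr_phase uph (fun r => (period j.+1 %| r + i)%N)).
rewrite (sum_periodic (f := fun t => (period j.+1 %| t)%N : nat)); last first.
  by move=> t; rewrite dvdn_addl.
rewrite (_ : (\sum_(r < period j.+1) _)%N = 1%N) ?mul1r//.
have N0 := period_gt0 L_gt0 j.+1.
rewrite (bigD1 (Ordinal N0))//= dvdn0 big1// => r r0.
rewrite gtnNdvd//; rewrite lt0n; apply: contra r0 => /eqP r0.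
by apply/eqP/val_inj.
Qed.

Definition late_toggle m i : set T := \bigcup_(j in [set j | (m <= j)%N]) toggle j i.

Lemma measurable_late_toggle m i : measurable (late_toggle m i).
Proof. by apply: bigcup_measurable => j _; exact: measurable_toggle. Qed.

(** Where the symbol at time [i] is flipped at infinitely many stages, a null set,
the value is [false]. *)
Definition limit i (u : T) : bool :=
  `[< exists M, forall m, (M <= m)%N -> approx m i u >].

Lemma limit_approx m i u : ~ late_toggle m i u -> limit i u = approx m i u.
Proof.
move=> nlate; have const n : (m <= n)%N -> approx n i u = approx m i u.
  move=> /subnKC <-; elim: (n - m)%N => [|k IH]; first by rewrite addn0.
  rewrite addnS approxS IH memNset ?addbF// => tog; apply: nlate.
  by exists (m + k)%N => //=; rewrite leq_addr.
apply/asboolP/idP => [[M /(_ (maxn M m))]|am].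
  by rewrite const ?leq_maxr//; apply; rewrite leq_maxl.
by exists m => n /const->.
Qed.

Lemma measurable_limit i : measurable_fun setT (limit i).
Proof.
apply: (measurable_fun_bool true); rewrite setTI.
rewrite (_ : _ @^-1` _ = \bigcup_M \bigcap_(m in [set m | (M <= m)%N])
   [set u | approx m i u]).
  apply: bigcupT_measurable => M; apply: bigcap_measurableType => m _.
  exact: (measurable_phase (uniform_phase_phase L_gt0 R m) (fun r => toeplitz m (r + i)%N)).
apply/seteqP; split => u /=.
  by move=> /asboolP[M uM]; exists M.
by move=> [M _ uM]; apply/asboolP; exists M.
Qed.

Hypothesis L_ge : forall j, (8 * j.+1 <= L j)%N.

Lemma period_growth m k : (period m * 2 ^ k <= period (m + k))%N.
Proof.
elim: k => [|k IH]; first by rewrite muln1 addn0.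
rewrite addnS periodS expnSr mulnA leq_mul//.
by apply: leq_trans (L_ge _); lia.
Qed.

(** The events [toggle j i] have probabilities decreasing at least geometrically,
so their union weighs at most twice the first one. *)
Lemma pr_late_toggle m i : pr U (late_toggle m i) <= 2 / (period m.+1)%:R.
Proof.
have mt := measurable_toggle.
have ml := measurable_late_toggle m i.
rewrite -lee_fin -prE//.
have sub : late_toggle m i `<=` \bigcup_k toggle (m + k)%N i.
  by move=> u [j /= lemj tj]; exists (j - m)%N => //; rewrite subnKC.
apply: le_trans (measure_sigma_subadditive _ _ ml sub) _ => //.
have e0 : 0 <= 2 / (period m.+1)%:R :> R by rewrite divr_ge0.
apply: le_trans (epsilon_trick0 xpredT e0); apply: lee_nneseries => // k _.
rewrite [leLHS]prE// lee_fin pr_toggle.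
have N0 j : 0 < (period j)%:R :> R by rewrite ltr0n period_gt0.
rewrite expnSr -addSn.
have := period_growth m.+1 k; rewrite -(ler_nat R) natrM => le2.
have -> : 2 / (period m.+1)%:R / (2 ^ k * 2)%:R = ((period m.+1)%:R * (2 ^ k)%:R)^-1 :> R.
  by rewrite natrM; field; rewrite pnatr_eq0 expn_eq0/= gt_eqF.
by rewrite lef_pV2// posrE// mulr_gt0// ltr0n expn_gt0.
Qed.

Definition late_window m n : set T := \bigcup_(i in `I_n) late_toggle m i.

Lemma measurable_late_window m n : measurable (late_window m n).
Proof. by apply: bigcup_measurable => i _; exact: measurable_late_toggle. Qed.

Lemma pr_late_window m n : pr U (late_window m n) <= n%:R * (2 / (period m.+1)%:R).
Proof.
apply: le_trans (pr_bigcup_ord _ _ (measurable_late_toggle m)) _.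
rewrite mulrC mulr_natr -[X in _ <= _ *+ X]card_ord -sumr_const.
by apply: ler_sum => i _; exact: pr_late_toggle.
Qed.

Lemma limit_approx_window m n i u : ~ late_window m n u -> (i < n)%N ->
  limit i u = approx m i u.
Proof. by move=> nbad ltin; apply: limit_approx => li; apply: nbad; exists i. Qed.

(** Since [L m] outgrows every constant, a window of one full period of stage [m],
even prolonged by [n], is correct up to a vanishing error. *)
Lemma pr_late_window_small n (eps : R) : 0 < eps ->
  exists M, forall m, (M <= m)%N -> pr U (late_window m (period m + n)) <= eps.
Proof.
move=> eps0; exists (Num.truncn (n.+1%:R / eps)).+1 => m ltm.
apply: le_trans (pr_late_window _ _) _; rewrite mulrA ler_pdivrMr ?ltr0n ?period_gt0//.
have h : n.+1%:R <= eps * m.+1%:R.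
  by rewrite mulrC -ler_pdivrMr// ltW// (lt_le_trans (truncnS_gt _))// ler_nat leqW.
have N0 := period_gt0 L_gt0 m.
have h1 : ((period m + n)%:R * 2 : R) <= n.+1%:R * (period m * 8)%:R.
  by rewrite -natrM -natrM ler_nat; nia.
have h2 : (period m * 8)%:R * m.+1%:R <= (period m.+1)%:R :> R.
  by rewrite -natrM ler_nat periodS -mulnA leq_mul.
have h3 := ler_wpM2r (ler0n R (period m * 8)) h.
have h4 := ler_wpM2l (ltW eps0) h2.
by apply: le_trans h1 (le_trans h3 _); apply: le_trans h4; rewrite mulrAC mulrA.
Qed.

Definition limit_process : binary_process R := make_process U measurable_limit.

Definition approx_process m : binary_process R :=
  periodic_process (uniform_phase_phase L_gt0 R m) (toeplitz m).

Lemma pr_limit_approx m n (Q : set (nat -> bool)) : determined n Q ->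
  `|pr U [set u | Q (limit ^~ u)] - pr U [set u | Q (approx m ^~ u)]| <=
  pr U (late_window m n).
Proof.
move=> dQ.
have mA : measurable [set u | Q (limit ^~ u)].
  exact: (measurable_determined measurable_limit dQ).
have mB : measurable [set u | Q (approx m ^~ u)].
  exact: (measurable_determined (@measurable_rv _ (approx_process m)) dQ).
have mbad := measurable_late_window m n.
have le1 : pr U [set u | Q (limit ^~ u)] <=
    pr U [set u | Q (approx m ^~ u)] + pr U (late_window m n).
  apply: le_trans (le_prU _ mB mbad); apply: le_pr => //; first exact: measurableU.
  move=> u Qu; have [bu|nbu] := pselect (late_window m n u); [by right|left].
  by apply: dQ Qu => i lti; rewrite (limit_approx_window nbu).
have le2 : pr U [set u | Q (approx m ^~ u)] <=
    pr U [set u | Q (limit ^~ u)] + pr U (late_window m n).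
  apply: le_trans (le_prU _ mA mbad); apply: le_pr => //; first exact: measurableU.
  move=> u Qu; have [bu|nbu] := pselect (late_window m n u); [by right|left].
  by apply: dQ Qu => i lti; rewrite (limit_approx_window nbu).
by rewrite ler_distl lerBlDr le1 le2.
Qed.

(** Both sides are within any [eps] of their counterparts at a late stage, where
they are equal. *)
Lemma stationary_limit : stationary limit_process.
Proof.
move=> k n x.
have mA j := measurable_agree (@measurable_rv _ limit_process) n j x.
rewrite (prE _ (mA k)) (prE _ (mA 0)); congr EFin.
pose Q j : set (nat -> bool) := [set z | forall i, (i < n)%N -> z (j + i)%N = x i].
have dQ j : determined (j + n) (Q j).
  by move=> z z' zz' Qz i lti; rewrite -zz' ?Qz// ltn_add2l.
apply/eqP; rewrite -subr_eq0 -normr_le0; apply/ler_addgt0Pl => eps eps0; rewrite addr0.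
have eps2 : 0 < eps / 2 by lra.
have [M /(_ M (leqnn _)) badM] := pr_late_window_small (k + n) eps2.
have Mk := pr_limit_approx M (dQ k); have M0 := pr_limit_approx M (dQ 0).
have le_bad l : (l <= k + n)%N -> pr U (late_window M l) <= eps / 2.
  move=> lekn; have lel : (l <= period M + (k + n))%N by exact: leq_trans (leq_addl _ _).
  apply: le_trans badM; apply: le_pr; [exact: measurable_late_window..|].
  by move=> u [i /= lti li]; exists i => //=; exact: leq_trans lti lel.
have eqM : pr U [set u | Q k (approx M ^~ u)] = pr U [set u | Q 0 (approx M ^~ u)].
  have sM : stationary (approx_process M).
    exact: stationary_periodic (toeplitz_periodic M).
  exact: (stationary_determined sM k (dQ 0)).
rewrite eqM in Mk.
have bk : pr U (late_window M (k + n)) <= eps / 2 by exact: le_bad.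
have b0 : pr U (late_window M (0 + n)) <= eps / 2 by apply: le_bad; rewrite leq_addl.
have -> : pr U [set u | Q k (limit ^~ u)] - pr U [set u | Q 0 (limit ^~ u)] =
  (pr U [set u | Q k (limit ^~ u)] - pr U [set u | Q 0 (approx M ^~ u)]) -
  (pr U [set u | Q 0 (limit ^~ u)] - pr U [set u | Q 0 (approx M ^~ u)]) by ring.
apply: le_trans (ler_normB _ _) _; rewrite (splitr eps).
by apply: lerD; [exact: le_trans Mk bk|exact: le_trans M0 b0].
Qed.

(** Over one period of stage [M] a periodic sequence contains each pattern a
number of times that does not depend on the phase. *)
Lemma ergodic_limit : ergodic limit_process.
Proof.
apply: ergodic_of_frequency => [|n Q eps dQ eps0]; first exact: stationary_limit.
have [M /(_ M (leqnn _)) badM] := pr_late_window_small n eps0.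
exists (period M), (\sum_(t < period M) `[< Q (fun i => toeplitz M (t + i)) >])%N,
  (late_window M (period M + n)); split => //.
- exact: period_gt0.
- by rewrite -[leqRHS]card_ord -sum1_card; apply: leq_sum => t _; case: asbool.
- exact: measurable_late_window.
move=> u nbad; rewrite -(@periodic_frequency _ _ _ (phase M u) (toeplitz_periodic M)).
rewrite natr_sum; apply: eq_bigr => t _; rewrite indicE; congr (nat_of_bool _)%:R.
apply/idP/asboolP; rewrite inE /=; apply: dQ => i lti;
  by rewrite (limit_approx_window nbad)//; have := ltn_ord t; lia.
Qed.

Lemma recurrent_limit k (eps : R) : 0 < eps -> exists2 N, (0 < N)%N &
  pr U [set u | ~ forall i, (i < k)%N -> limit (i + N)%N u = limit i u] <= eps.
Proof.
move=> eps0; have [M /(_ M (leqnn _)) badM] := pr_late_window_small k eps0.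
exists (period M); first exact: period_gt0.
apply: le_trans badM; apply: le_pr.
- pose Q : set (nat -> bool) :=
    [set z | ~ forall i, (i < k)%N -> z (i + period M)%N = z i].
  have dQ : determined (k + period M) Q.
    move=> z z' zz' Qz h; apply: Qz => i lti; rewrite !zz' ?h//; lia.
  exact: (measurable_determined measurable_limit dQ).
- exact: measurable_late_window.
move=> u /= nper; apply: contrapT => nbad; apply: nper => i lti.
rewrite !(limit_approx_window nbad); [|lia..].
by rewrite /approx addnA toeplitz_periodic.
Qed.

(** The multiple [D * period D] is a period at stage [D], but not at stage [D.+1]
since [0 < D < L D].  On the event that time 0 is flipped at that stage, which has
probability [1 / period D.+1], the symbols at times 0 and [D * period D] differ
at stage [D.+1]; later flips are too rare to undo this. *)
Lemma aperiodic_limit D : (0 < D)%N ->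
  exists M, 0 < pr U [set u | limit 0 u <> limit (D * M)%N u].
Proof.
move=> D0; exists (period D); set s := (D * period D)%N.
have N0 j : 0 < (period j)%:R :> R by rewrite ltr0n period_gt0.
have mX : measurable [set u | limit 0 u <> limit s u].
  pose Q : set (nat -> bool) := [set z | z 0 <> z s].
  have dQ : determined s.+1 Q by move=> z z' zz' Qz; rewrite /Q/= -!zz'.
  exact: (measurable_determined measurable_limit dQ).
have sub : toggle D 0 `<=` [set u | limit 0 u <> limit s u] `|`
    (late_toggle D.+1 0 `|` late_toggle D.+1 s).
  move=> u tog.
  have [|/not_orP[n0 ns]] := pselect (late_toggle D.+1 0 u \/ late_toggle D.+1 s u).
    by right.
  have ntog : ~ toggle D s u.
    rewrite /toggle/= in tog *; rewrite addn0 in tog.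
    rewrite dvdn_addr// periodS /s (mulnC D) dvdn_pmul2l ?period_gt0// gtnNdvd//.
    by apply: leq_trans (L_ge D); lia.
  have approxs : approx D s u = approx D 0 u.
    by rewrite /approx addn0 addnC toeplitz_dvdn// dvdn_mull.
  left; rewrite /= (limit_approx n0) (limit_approx ns) !approxS approxs.
  by rewrite (mem_set tog) (memNset ntog); case: approx.
have mlate := measurableU _ _ (measurable_late_toggle D.+1 0)
  (measurable_late_toggle D.+1 s).
have := le_pr U (measurable_toggle D 0) (measurableU _ _ mX mlate) sub.
rewrite pr_toggle => /le_trans/(_ (le_prU U mX mlate)).
have := le_prU U (measurable_late_toggle D.+1 0) (measurable_late_toggle D.+1 s).
have := pr_late_toggle D.+1 0; have := pr_late_toggle D.+1 s.
have : 2 / (period D.+2)%:R <= (period D.+1)%:R^-1 / 4 :> R.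
  rewrite ler_pdivrMr// mulrAC ler_pdivlMr// ler_pdivlMl// -natrM -natrM ler_nat.
  rewrite [in leqRHS]periodS; apply: leq_mul => //.
  by apply: leq_trans (L_ge _); lia.
have : 0 < (period D.+1)%:R^-1 :> R by rewrite invr_gt0.
move: (pr U _) (pr U _) (pr U _) (pr U _) (_^-1) (2 / _).
by move=> a b c e f g; lra.
Qed.

Lemma not_markov_limit : ~ finite_order_markov limit_process.
Proof.
move=> [_ [k]]; apply: not_markov; first exact: stationary_limit.
  exact: recurrent_limit.
exact: aperiodic_limit.
Qed.

End toeplitz.

(** * From almost sure answers to answers in probability *)

Section from_almost_sure.
Context d (T : measurableType d) (R : realType) (P : probability T R).

Lemma cvg_probability_ae (E : nat -> set T) : (forall n, measurable (E n)) ->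
  {ae P, forall w, \forall n \near \oo, E n w} -> P (E n) @[n --> \oo] --> 1%E.
Proof.
move=> mE [Z [mZ PZ subZ]].
pose G M := \bigcap_(n in [set n | (M <= n)%N]) E n.
have mG M : measurable (G M) by apply: bigcap_measurableType => n _; exact: mE.
have mUG : measurable (\bigcup_M G M) by exact: bigcupT_measurable.
have PUG : P (\bigcup_M G M) = 1%E.
  have PC : P (~` Z) = 1%E by rewrite probability_setC// PZ sube0.
  apply/eqP; rewrite eq_le probability_le1//= -PC; apply: le_measure; rewrite ?inE//.
    exact: measurableC.
  move=> w nZw; have /contrapT[M _ EM] : ~ ~ \forall n \near \oo, E n w.
    by move=> nE; apply: nZw; apply: subZ.
  by exists M.
have cG : P (G n) @[n --> \oo] --> 1%E.
  rewrite -PUG; apply: nondecreasing_cvg_mu => // M M' leMM'.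
  by apply/subsetPset => w GM n /= lenM'; apply: GM => /=; exact: leq_trans lenM'.
apply: squeeze_cvge cG (cvg_cst 1%E); apply: nearW => n.
rewrite probability_le1// andbT; apply: le_measure; rewrite ?inE// => w.
by apply=> /=.
Qed.

Lemma cvg_probability_gt (E : nat -> set T) (e : R) : e < 1 ->
  P (E n) @[n --> \oo] --> 1%E -> exists M, forall n, (M <= n)%N -> e < pr P (E n).
Proof.
move=> e1 /fine_cvgP[_ /cvgr_gt/(_ e e1)[M _ ME]].
by exists M => n leMn; exact: ME.
Qed.

End from_almost_sure.

Section answers.
Variable g : test_sequence.

Definition answered (a : answer) n : set (nat -> bool) :=
  [set z | @g n [tuple z i | i < n] = a].

Lemma determined_answered a n : determined n (answered a n).
Proof.
move=> z z' zz'; rewrite /answered/= (_ : [tuple z i | i < n] = [tuple z' i | i < n])//.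
by apply: eq_from_tnth => i; rewrite !tnth_mktuple zz'.
Qed.

Context (R : realType).

Lemma measurable_answered a n (p : binary_process R) :
  measurable [set w | @g n (prefix_of (p := p) n w) = a].
Proof.
exact: (measurable_determined (@measurable_rv _ p) (@determined_answered a n)).
Qed.

Lemma classification_pointwise_in_probability (G : binary_process R -> Prop) :
  classification_pointwise G g -> classification_in_probability G g.
Proof.
move=> [yes no]; split=> [p Gp|p sep nGp].
  by apply: cvg_probability_ae (yes p Gp) => n; exact: measurable_answered.
by apply: cvg_probability_ae (no p sep nGp) => n; exact: measurable_answered.
Qed.

(** * The diagonal argument *)

Hypothesis classif : classification_in_probability (@finite_order_markov R) g.

(** The number of phases at which the test reads a word of length [n] and says
YES; a count depending on [L] only through [L 0, ..., L (m - 1)]. *)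
Definition yes_count L m n : nat :=
  (\sum_(r < period L m) `[< answered YES n (fun i => toeplitz L m (r + i)) >])%N.

Lemma pr_approx_yes L (L_gt0 : forall j, (0 < L j)%N) m n :
  pr (uniform_prob (@ltr01 R)) [set u | answered YES n (fun i => approx L m i u)] =
  (yes_count L m n)%:R / (period L m)%:R.
Proof. exact: (pr_periodic (uniform_phase_phase L_gt0 R m)). Qed.

Lemma periodic_yes L m : (forall j, (0 < L j)%N) ->
  exists2 n, (m <= n)%N & (3 * period L m <= 4 * yes_count L m n)%N.
Proof.
move=> L_gt0; have [yes _] := classif.
have pm := finite_order_markov_periodic (uniform_phase_phase L_gt0 R m)
  (@toeplitz_periodic L m).
have lt1 : 3 / 4 < 1 :> R by lra.
have [M /(_ (maxn m M) (leq_maxr _ _))] := cvg_probability_gt lt1 (yes _ pm).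
move=> yesM; exists (maxn m M); first exact: leq_maxl.
move: yesM.
have N0 : 0 < (period L m)%:R :> R by rewrite ltr0n period_gt0.
set q := pr _ _; have -> : q = (yes_count L m (maxn m M))%:R / (period L m)%:R.
  exact: pr_approx_yes.
by rewrite ltr_pdivlMr// => h; rewrite -(ler_nat R) !natrM; lra.
Qed.

Lemma eq_period L L' m : (forall j, (j < m)%N -> L j = L' j) -> period L m = period L' m.
Proof. by move=> LL'; apply: eq_bigr => j _; rewrite LL'. Qed.

Lemma eq_toeplitz L L' m t : (forall j, (j < m)%N -> L j = L' j) ->
  toeplitz L m t = toeplitz L' m t.
Proof.
move=> LL'; congr odd; apply: eq_bigr => j _.
by rewrite (@eq_period L L')// => i lti; rewrite LL'// (leq_trans lti).
Qed.

Section diagonal.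
Variable sel : nat -> (nat -> nat) -> nat.

(** [sel m L] stands for a length on which the test says YES at stage [m] of the
sequence [L].  As the ratios not yet chosen do not matter at stage [m], they are
filled in with the default value 1. *)
Fixpoint ratios (m : nat) : seq nat :=
  if m is m'.+1 then
    rcons (ratios m') (8 * (sel m' (nth 1 (ratios m')) + m'.+1))
  else [::].

Definition ratio (m : nat) : nat := 8 * (sel m (nth 1 (ratios m)) + m.+1).

Lemma size_ratios m : size (ratios m) = m.
Proof. by elim: m => //= m IH; rewrite size_rcons IH. Qed.

Lemma nth_ratios m j : (j < m)%N -> nth 1 (ratios m) j = ratio j.
Proof.
elim: m => // m IH; rewrite ltnS leq_eqVlt => /orP[/eqP ->|ltjm]/=.
  by rewrite nth_rcons size_ratios ltnn eqxx.
by rewrite nth_rcons size_ratios ltjm IH.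
Qed.

Lemma nth_ratios_gt0 m j : (0 < nth 1 (ratios m) j)%N.
Proof.
have [ltjm|lemj] := ltnP j m; first by rewrite nth_ratios// /ratio; lia.
by rewrite nth_default// size_ratios.
Qed.

End diagonal.

Lemma no_classification : False.
Proof.
have sel_ex (mL : nat * (nat -> nat)) : exists n, (forall j, (0 < mL.2 j)%N) ->
    (mL.1 <= n)%N /\ (3 * period mL.2 mL.1 <= 4 * yes_count mL.2 mL.1 n)%N.
  have [L0|nL0] := pselect (forall j, (0 < mL.2 j)%N); last by exists 0.
  by have [n len yesn] := periodic_yes mL.1 L0; exists n.
have [sel' sel'P] := choice sel_ex.
pose sel m L := sel' (m, L).
have selP m L : (forall j, (0 < L j)%N) ->
    (m <= sel m L)%N /\ (3 * period L m <= 4 * yes_count L m (sel m L))%N.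
  by move=> L0; have := sel'P (m, L) L0.
pose L := ratio sel.
have L_ge j : (8 * j.+1 <= L j)%N by rewrite /L /ratio; lia.
have L_gt0 j : (0 < L j)%N by apply: leq_trans (L_ge j); lia.
pose n m := sel m (nth 1 (ratios sel m)).
have nP m : (m <= n m)%N /\ (3 * period L m <= 4 * yes_count L m (n m))%N.
  have LL j : (j < m)%N -> nth 1 (ratios sel m) j = L j by exact: nth_ratios.
  have [] := selP m _ (nth_ratios_gt0 sel m); split => //.
  rewrite -(eq_period LL); apply: leq_trans; first by eassumption.
  rewrite leq_mul2l/= eq_leq// /yes_count (eq_period LL); apply: eq_bigr => r _.
  by congr (nat_of_bool `[< answered _ _ _ >]); apply/funext => i; exact: eq_toeplitz.
have nmk := @not_markov_limit L L_gt0 R L_ge.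
have [_ no] := classif.
have half : 1 / 2 < 1 :> R by lra.
have sep : stationary_ergodic (limit_process L_gt0 R).
  by split; [exact: stationary_limit|exact: ergodic_limit].
have [M /(_ (n M) (nP M).1)] := cvg_probability_gt half (no _ sep nmk).
have [_ yesM] := nP M.
set X := limit_process L_gt0 R.
have eNO : [set w | @g (n M) (prefix_of (p := X) (n M) w) = NO] =
    ~` [set w | @g (n M) (prefix_of (p := X) (n M) w) = YES].
  by apply/seteqP; split => w /=; case: g => // /(_ erefl).
rewrite eNO pr_setC; last exact: measurable_answered.
have := @pr_limit_approx L L_gt0 R M (n M) _ (@determined_answered YES (n M)).
rewrite (pr_approx_yes L_gt0).
set x := pr _ _.
have N0 : 0 < (period L M)%:R :> R by rewrite ltr0n period_gt0.
have : 3 / 4 <= (yes_count L M (n M))%:R / (period L M)%:R :> R.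
  rewrite ler_pdivlMr//; move: yesM; rewrite -(ler_nat R) !natrM; lra.
have := @pr_late_window L L_gt0 R L_ge M (n M).
have : (n M)%:R * (2 / (period L M.+1)%:R) <= 1 / 4 :> R.
  rewrite mulrA ler_pdivrMr ?ltr0n ?(period_gt0 L_gt0)//.
  suff : (8 * n M <= period L M.+1)%N by rewrite -(ler_nat R) natrM; lra.
  rewrite periodS; apply: leq_trans (leq_pmull _ (period_gt0 L_gt0 M)).
  by rewrite /L /ratio -/(n M); lia.
rewrite ler_norml => h1 h2 h3 /andP[h4 h5] h6; move: h1 h2 h3 h4 h5 h6.
move: (pr _ (late_window _ _ _)) (_ / (period L M)%:R) (_ * (2 / _)) => b y c.
by move: x => x *; lra.
Qed.

End answers.

Theorem corollary1 (R : realType) :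
  ~ (exists g : test_sequence,
       classification_pointwise (@finite_order_markov R) g) /\
  ~ (exists g : test_sequence,
       classification_in_probability (@finite_order_markov R) g).
Proof.
split=> -[g classif]; apply: (@no_classification g R) => //.
exact: classification_pointwise_in_probability.
Qed.
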